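(* Let $\mathbf{S}=\{A_1,\dots,A_m\}\subset\mathbb{S}^n$, $b\in\mathbb{R}^m$, $\varepsilon\in(0,1)$, and consider the Triangle Algorithm testing if $b\in SH(\mathbf{S})$ by searching for an $\varepsilon$-approximate solution. Let the set of pivots generated by the algorithm be $\mathbf{V}=\{V_1,\dots,V_T\}$, where $V_i=v_iv_i^T$, $\Vert v_i\Vert=1$, $i=1,\dots,T$, and let $S(\mathbf{V})=\{p(V_1),\dots,p(V_T)\}\subset\mathbb{R}^m$. Ignoring the complexity of the power method needed to compute $\mathbf{V}$ (that is, not counting the cost of finding, for a given iterate, a rank-one pivot in $\mathbf{\Delta}_n$ or certifying that none exists), the overall complexity (number of arithmetic operations) of the Spectrahull Triangle Algorithm is $O(mn^2/\varepsilon^2)$. Alternatively, the overall complexity of the CHM-based Triangle Algorithm is $$O\left(mn^2T+mN^2+\frac{N}{\varepsilon^2}\right)$$ for some $N\le T=O(1/\varepsilon^2)$, where $N$ is the cardinality of the subset of $S(\mathbf{V})$ used as pivots in the convex hull membership iterations.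
   Context: $\mathbb{S}^n$: real symmetric $n\times n$ matrices, $X\bullet Y=\mathrm{Tr}(XY)$. Spectraplex: $\mathbf{\Delta}_n=\{X\in\mathbb{S}^n: \mathrm{Tr}(X)=1,\ X\succeq 0\}$. $p(X)=(A_1\bullet X,\dots,A_m\bullet X)^T\in\mathbb{R}^m$, spectrahull $SH(\mathbf{S})=\{p(X):X\in\mathbf{\Delta}_n\}$. $R=\max\{\Vert b-p(X)\Vert:X\in\mathbf{\Delta}_n\}$. An $\varepsilon$-approximate solution is $X\in\mathbf{\Delta}_n$ with $\Vert p(X)-b\Vert\le\varepsilon R$. A pivot at $X'\in\mathbf{\Delta}_n$ is $V\in\mathbf{\Delta}_n$ with $\Vert p(X')-p(V)\Vert\ge\Vert b-p(V)\Vert$, equivalently $A\bullet V\le\frac12(\Vert p(X')\Vert^2-\Vert b\Vert^2)$ with $A=\sum_{i=1}^m(A_i\bullet X'-b_i)A_i$. If $X'$ admits no pivot it is a witness: the orthogonal bisecting hyperplane of the segment from $b$ to $p(X')$ separates $b$ from $SH(\mathbf{S})$. Spectrahull Triangle Algorithm: start at $X'=ee^T/n$, $e=(1,\dots,1)^T$. Repeat: compute $p(X')$; if $\Vert p(X')-b\Vert\le\varepsilon R$, output $X'$ and stop; compute $A=\sum_{i=1}^m(A_i\bullet X'-b_i)A_i$; if a pivot exists, obtain a rank-one pivot $V=vv^T$, $\Vert v\Vert=1$ (found by applying the power method to estimate the least eigenvalue of $A$), let $\alpha_*$ minimize $\Vert(1-\alpha)p(X')+\alpha p(V)-b\Vert$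 over $\alpha\in[0,1]$, and replace $X'$ by $(1-\alpha_* )X'+\alpha_*V$; if no pivot exists, output a witness and stop. CHM-based Triangle Algorithm (CHM = convex hull membership, testing if a point lies in the convex hull of a finite set in $\mathbb{R}^m$): the rank-one pivots $V_1,V_2,\dots$ generated so far and their images $p(V_1),p(V_2),\dots$ are stored. At each iterate $p(X')$, one first searches for a pivot among the stored points $p(V_i)$, i.e. a stored point with $\Vert p(X')-p(V_i)\Vert\ge\Vert b-p(V_i)\Vert$; if one exists the iterate is replaced by the point nearest to $b$ on the segment from $p(X')$ to $p(V_i)$ (updating convex-combination coefficients). Only if no stored point is a pivot is a new rank-one pivot in $\mathbf{\Delta}_n$ generated by the power method applied to the matrix $A$ of the current iterate; it is then added to the stored set. The algorithm stops on reaching an $\varepsilon$-approximate solution or when no pivot exists in $\mathbf{\Delta}_n$. *)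

(* Defs.v *)
From HB Require Import structures.
From mathcomp Require Import all_boot all_order all_algebra.
From mathcomp Require Import reals.

Set Implicit Arguments.
Unset Strict Implicit.
Unset Printing Implicit Defensive.

Import Order.TTheory GRing.Theory Num.Theory.
Local Open Scope ring_scope.

(* Euclidean norm: the norm that MathComp-Analysis puts on matrices is the
   sup norm, so it is not used here. *)
Definition norm2 (R : realType) k (x : 'cV[R]_k) : R :=
  Num.sqrt (\sum_i x i 0 ^+ 2).

Definition frob (R : realType) n (X Y : 'M[R]_n) : R := \tr (X *m Y).

Definition psd (R : realType) n (X : 'M[R]_n) : Prop :=
  X^T = X /\ forall x : 'cV[R]_n, 0 <= (x^T *m X *m x) 0 0.

Definition spectraplex (R : realType) n (X : 'M[R]_n) : Prop :=
  \tr X = 1 /\ psd X.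

Definition pimage (R : realType) m n (A : 'I_m -> 'M[R]_n) (X : 'M[R]_n) :
  'cV[R]_m := \col_i frob (A i) X.

Definition outer (R : realType) n (v : 'cV[R]_n) : 'M[R]_n := v *m v^T.

Definition is_radius (R : realType) m n (A : 'I_m -> 'M[R]_n) (b : 'cV[R]_m)
    (rad : R) : Prop :=
  (exists X, spectraplex X /\ norm2 (b - pimage A X) = rad) /\
  (forall X, spectraplex X -> norm2 (b - pimage A X) <= rad).

Definition approx_solution (R : realType) m n (A : 'I_m -> 'M[R]_n)
    (b : 'cV[R]_m) (eps rad : R) (X : 'M[R]_n) : Prop :=
  spectraplex X /\ norm2 (pimage A X - b) <= eps * rad.

Definition pivot (R : realType) m n (A : 'I_m -> 'M[R]_n) (b : 'cV[R]_m)
    (X V : 'M[R]_n) : Prop :=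
  spectraplex V /\
  norm2 (b - pimage A V) <= norm2 (pimage A X - pimage A V).

Definition witness (R : realType) m n (A : 'I_m -> 'M[R]_n) (b : 'cV[R]_m)
    (X : 'M[R]_n) : Prop :=
  spectraplex X /\ forall V, ~ pivot A b X V.

Definition rank_one_pivot (R : realType) m n (A : 'I_m -> 'M[R]_n)
    (b : 'cV[R]_m) (X : 'M[R]_n) (v : 'cV[R]_n) : Prop :=
  norm2 v = 1 /\ pivot A b X (outer v).

Definition nearest_step (R : realType) m n (A : 'I_m -> 'M[R]_n)
    (b : 'cV[R]_m) (X V X' : 'M[R]_n) : Prop :=
  let dist a := norm2 ((1 - a) *: pimage A X + a *: pimage A V - b) in
  exists a : R, [/\ 0 <= a <= 1, X' = (1 - a) *: X + a *: V &
    forall a', 0 <= a' <= 1 -> dist a <= dist a'].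

Definition start (R : realType) n : 'M[R]_n := const_mx (n%:R^-1).

Inductive outcome (K : Type) (n : nat) : Type :=
| Approx of 'M[K]_n
| Witness of 'M[K]_n.
Arguments Approx {K n} _.
Arguments Witness {K n} _.

(* [spectrahull_exec A b eps rad X vs out]: from the iterate [X] the
   Spectrahull Triangle Algorithm can stop with the output [out] after
   generating the rank-one pivots given by the unit vectors [vs], in order. *)
Inductive spectrahull_exec (R : realType) m n (A : 'I_m -> 'M[R]_n)
    (b : 'cV[R]_m) (eps rad : R) :
    'M[R]_n -> seq 'cV[R]_n -> outcome R n -> Prop :=
| Sp_approx X :
    approx_solution A b eps rad X ->
    spectrahull_exec A b eps rad X [::] (Approx X)
| Sp_witness X :
    ~ approx_solution A b eps rad X -> witness A b X ->
    spectrahull_exec A b eps rad X [::] (Witness X)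
| Sp_step X v X' vs out :
    ~ approx_solution A b eps rad X -> rank_one_pivot A b X v ->
    nearest_step A b X (outer v) X' ->
    spectrahull_exec A b eps rad X' vs out ->
    spectrahull_exec A b eps rad X (v :: vs) out.

(* [chm_exec A b eps rad vs X vs' used out]: from the iterate [X] and the
   stored vectors [vs] the CHM-based algorithm can stop with the output [out];
   [vs'] is the final store and [used] lists, with repetitions, the stored
   vectors that served as pivots in the convex hull membership iterations.
   A freshly generated pivot only joins the store; the next search uses it. *)
Inductive chm_exec (R : realType) m n (A : 'I_m -> 'M[R]_n)
    (b : 'cV[R]_m) (eps rad : R) :
    seq 'cV[R]_n -> 'M[R]_n ->
    seq 'cV[R]_n -> seq 'cV[R]_n -> outcome R n -> Prop :=
| Chm_approx vs X :
    approx_solution A b eps rad X ->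
    chm_exec A b eps rad vs X vs [::] (Approx X)
| Chm_witness vs X :
    ~ approx_solution A b eps rad X -> witness A b X ->
    chm_exec A b eps rad vs X vs [::] (Witness X)
| Chm_stored vs X v X' vs' used out :
    ~ approx_solution A b eps rad X ->
    v \in vs -> pivot A b X (outer v) ->
    nearest_step A b X (outer v) X' ->
    chm_exec A b eps rad vs X' vs' used out ->
    chm_exec A b eps rad vs X vs' (v :: used) out
| Chm_generate vs X v vs' used out :
    ~ approx_solution A b eps rad X ->
    (forall w, w \in vs -> ~ pivot A b X (outer w)) ->
    rank_one_pivot A b X v ->
    chm_exec A b eps rad (rcons vs v) X vs' used out ->
    chm_exec A b eps rad vs X vs' used out.

(* A program computes over a bare type [K] of numbers.  Since nothing is known
   about [K], a program written for all [K] can produce or compare numbers only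
   through the instructions below, each of which costs one operation, except
   [Query]: the call to the power method, which is free. *)

Inductive arith := OpAdd | OpSub | OpMul | OpDiv.

Inductive prog (K : Type) (n : nat) (T : Type) : Type :=
| Ret of T
| Const of nat & (K -> prog K n T)
| Arith of arith & K & K & (K -> prog K n T)
| Leq of K & K & (bool -> prog K n T)
| Query of 'M[K]_n & K & (option 'cV[K]_n -> prog K n T).
Arguments Ret {K n T} _.

Fixpoint bind K n T U (p : prog K n T) (f : T -> prog K n U) : prog K n U :=
  match p with
  | Ret x => f x
  | Const c k => Const c (fun x => bind (k x) f)
  | Arith o x y k => Arith o x y (fun z => bind (k z) f)
  | Leq x y k => Leq x y (fun c => bind (k c) f)
  | Query M t k => Query M t (fun a => bind (k a) f)
  end.

Notation "'let*' x := p 'in' q" := (bind p (fun x => q))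
  (at level 200, x name, p at level 100, q at level 200).

Definition arith_fun (R : realType) (o : arith) : R -> R -> R :=
  match o with
  | OpAdd => fun x y => x + y
  | OpSub => fun x y => x - y
  | OpMul => fun x y => x * y
  | OpDiv => fun x y => x / y
  end.

(* The power method, called on a symmetric matrix [M] and a threshold [t],
   either returns a unit vector v with M . vv^T <= t or certifies that M . V > t
   on the whole spectraplex. *)
Definition power_method_spec (R : realType) n
    (oracle : 'M[R]_n -> R -> option 'cV[R]_n) : Prop :=
  forall M t, M^T = M ->
    match oracle M t with
    | Some v => norm2 v = 1 /\ frob M (outer v) <= t
    | None => forall V, spectraplex V -> t < frob M V
    end.

(* The first component is the number of operations executed. *)
Fixpoint run (R : realType) n (oracle : 'M[R]_n -> R -> option 'cV[R]_n) T
    (p : prog R n T) : nat * T :=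
  match p with
  | Ret x => (0%N, x)
  | Const c k =>
      let r := run oracle (k c%:R) in (r.1.+1, r.2)
  | Arith o x y k =>
      let r := run oracle (k (arith_fun o x y)) in (r.1.+1, r.2)
  | Leq x y k =>
      let r := run oracle (k (x <= y)) in (r.1.+1, r.2)
  | Query M t k => run oracle (k (oracle M t))
  end.

Definition op K n (o : arith) (x y : K) : prog K n K := Arith o x y Ret.
Definition cst K n (c : nat) : prog K n K := Const c Ret.
Definition leqp K n (x y : K) : prog K n bool := Leq x y Ret.
Definition query K n (M : 'M[K]_n) (t : K) : prog K n (option 'cV[K]_n) :=
  Query M t Ret.
Arguments op {K n} o x y.
Arguments cst {K n} c.
Arguments leqp {K n} x y.
Arguments query {K n} M t.

Definition ord_elim0 T (i : 'I_0) : T := False_rect T (notF (ltn_ord i)).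

Definition fcons k T (x : T) (f : 'I_k -> T) (i : 'I_k.+1) : T :=
  if unlift ord0 i is Some j then f j else x.

Definition frcons k T (f : 'I_k -> T) (x : T) (i : 'I_k.+1) : T :=
  if unlift ord_max i is Some j then f j else x.

Fixpoint tab K n T k : ('I_k -> prog K n T) -> prog K n ('I_k -> T) :=
  match k with
  | 0%N => fun _ => Ret (@ord_elim0 T)
  | k'.+1 => fun f =>
      let* x := f ord0 in
      let* g := tab (fun i => f (lift ord0 i)) in
      Ret (fcons x g)
  end.

Definition tab_cV K n k (f : 'I_k -> prog K n K) : prog K n 'cV[K]_k :=
  let* g := tab f in Ret (\col_i g i).

Definition tab_mx K n k (f : 'I_k -> 'I_k -> prog K n K) : prog K n 'M[K]_k :=
  let* g := tab (fun i => tab (f i)) in Ret (\matrix_(i, j) g i j).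

Fixpoint sum_fun K n k : ('I_k -> K) -> prog K n K :=
  match k with
  | 0%N => fun _ => cst 0
  | k'.+1 => fun x =>
      let* s := sum_fun n (fun i => x (lift ord0 i)) in
      op OpAdd (x ord0) s
  end.
Arguments sum_fun {K} n {k} x.

Definition dot K n k (x y : 'I_k -> K) : prog K n K :=
  let* z := tab (fun i => op OpMul (x i) (y i)) in sum_fun n z.
Arguments dot {K} n {k} x y.

Definition dot_cV K n k (x y : 'cV[K]_k) : prog K n K :=
  dot n (fun i => x i ord0) (fun i => y i ord0).
Arguments dot_cV {K} n {k} x y.

Definition comp_frob K n (X Y : 'M[K]_n) : prog K n K :=
  let* z := tab (fun i => dot n (X i) (fun j => Y j i)) in sum_fun n z.

Definition comp_image K m n (A : 'I_m -> 'M[K]_n) (X : 'M[K]_n) :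
  prog K n 'cV[K]_m := tab_cV (fun i => comp_frob (A i) X).

Definition comp_outer K n (v : 'cV[K]_n) : prog K n 'M[K]_n :=
  tab_mx (fun i j => op OpMul (v i ord0) (v j ord0)).

Definition comp_start K n : prog K n 'M[K]_n :=
  let* c1 := cst 1 in
  let* cn := cst n in
  let* c := op OpDiv c1 cn in
  Ret (const_mx c).

(* The matrix sum_i (p_i - b_i) A_i, from r = p - b. *)
Definition comp_gradient K m n (A : 'I_m -> 'M[K]_n) (r : 'cV[K]_m) :
  prog K n 'M[K]_n :=
  tab_mx (fun j l => dot n (fun i => r i ord0) (fun i => A i j l)).

(* The threshold (|p|^2 - |b|^2) / 2, from xx = |p|^2 and bb = |b|^2. *)
Definition comp_threshold K n (xx bb : K) : prog K n K :=
  let* c2 := cst 2 in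
  let* d := op OpSub xx bb in
  op OpDiv d c2.

(* The minimizer over [0, 1] of |(1 - a) p + a q - b|, from
   xx = p.p, xq = p.q, qq = q.q, xb = p.b, bq = b.q: with
   s = (b - p).(q - p) and l = |q - p|^2 it is s / l clamped to [0, 1]. *)
Definition comp_step K n (xx xq qq xb bq : K) : prog K n K :=
  let* zero := cst 0 in
  let* one := cst 1 in
  let* d1 := op OpSub xx xq in
  let* d2 := op OpSub qq xq in
  let* l := op OpAdd d1 d2 in
  let* d3 := op OpSub bq xb in
  let* s := op OpAdd d3 d1 in
  let* neg := leqp s zero in
  if neg then Ret zero else
  let* big := leqp l s in
  if big then Ret one else
  op OpDiv s l.

(* [fuel] bounds the number of passes; the result [None] means that it is
   exhausted.  A completed run returns the output and the generated vectors. *)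

Fixpoint spectrahull_loop K m n (A : 'I_m -> 'M[K]_n) (b : 'cV[K]_m)
    (eps rad : K) (fuel : nat) (X : 'M[K]_n) (vs : seq 'cV[K]_n) :
    prog K n (option (outcome K n * seq 'cV[K]_n)) :=
  match fuel with
  | 0%N => Ret None
  | fuel'.+1 =>
    let* p := comp_image A X in
    let* r := tab_cV (fun i => op OpSub (p i ord0) (b i ord0)) in
    let* d := dot_cV n r r in
    let* e := op OpMul eps rad in
    let* e2 := op OpMul e e in
    let* stop := leqp d e2 in
    if stop then Ret (Some (Approx X, vs)) else
    let* M := comp_gradient A r in
    let* xx := dot_cV n p p in
    let* bb := dot_cV n b b in
    let* t := comp_threshold n xx bb in
    let* answer := query M t in
    match answer with
    | None => Ret (Some (Witness X, vs))
    | Some v =>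
      let* V := comp_outer v in
      let* q := comp_image A V in
      let* xq := dot_cV n p q in
      let* qq := dot_cV n q q in
      let* xb := dot_cV n p b in
      let* bq := dot_cV n b q in
      let* a := comp_step n xx xq qq xb bq in
      let* one := cst 1 in
      let* c := op OpSub one a in
      let* X' := tab_mx (fun i j =>
        let* y := op OpMul c (X i j) in
        let* z := op OpMul a (V i j) in
        op OpAdd y z) in
      spectrahull_loop A b eps rad fuel' X' (rcons vs v)
    end
  end.

Definition spectrahull K m n (A : 'I_m -> 'M[K]_n) (b : 'cV[K]_m)
    (eps rad : K) (fuel : nat) :
    prog K n (option (outcome K n * seq 'cV[K]_n)) :=
  let* X := comp_start K n in
  spectrahull_loop A b eps rad fuel X [::].

(* The iterate X' is the convex combination [wgt0] X_0 + sum_i [wgt] i V_i of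
   the starting point X_0 and of the stored pivots V_0, ..., V_{t-1}.  A
   convex hull membership iteration updates the weights and the inner products
   of p(X') below; neither X' nor p(X') is recomputed. *)

Record store (K : Type) (m n t : nat) := Store {
  vec : 'I_t -> 'cV[K]_n;     (* v_i, where V_i = v_i v_i^T *)
  img : 'I_t -> 'cV[K]_m;     (* p(V_i) *)
  gram : 'I_t -> 'I_t -> K;   (* p(V_i) . p(V_j) *)
  bimg : 'I_t -> K;           (* b . p(V_i) *)
  ximg : 'I_t -> K;           (* p(X') . p(V_i) *)
  wgt : 'I_t -> K;
  wgt0 : K;
  xx : K;                     (* p(X') . p(X') *)
  xb : K                      (* p(X') . b *)
}.

Definition move_to K m n t (s : store K m n t) (i : 'I_t) :
    prog K n (store K m n t) :=
  let* a := comp_step n (xx s) (ximg s i) (gram s i i) (xb s) (bimg s i) in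
  let* one := cst 1 in
  let* c := op OpSub one a in
  let mix x y :=
    let* x' := op OpMul c x in
    let* y' := op OpMul a y in
    op OpAdd x' y' in
  let* ximg' := tab (fun j => mix (ximg s j) (gram s i j)) in
  let* wgt' := tab (fun j =>
    let* w := op OpMul c (wgt s j) in
    if j == i then op OpAdd w a else Ret w) in
  let* wgt0' := op OpMul c (wgt0 s) in
  (* |p'|^2 = c p.p' + a q.p' for the new image p' = c p + a q *)
  let* xx0 := mix (xx s) (ximg s i) in
  let* xx' := mix xx0 (ximg' i) in
  let* xb' := mix (xb s) (bimg s i) in
  Ret (Store (vec s) (img s) (gram s) (bimg s) ximg' wgt' wgt0' xx' xb').

(* p(X'), from the image [p0] of the starting point. *)
Definition comp_current K m n t (p0 : 'cV[K]_m) (s : store K m n t) :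
    prog K n 'cV[K]_m :=
  tab_cV (fun l =>
    let* y := dot n (wgt s) (fun i => img s i l ord0) in
    let* z := op OpMul (wgt0 s) (p0 l ord0) in
    op OpAdd z y).

(* X', from the starting point [X0]. *)
Definition comp_iterate K m n t (X0 : 'M[K]_n) (s : store K m n t) :
    prog K n 'M[K]_n :=
  let* Vs := tab (fun i => comp_outer (vec s i)) in
  tab_mx (fun j l =>
    let* y := dot n (wgt s) (fun i => Vs i j l) in
    let* z := op OpMul (wgt0 s) (X0 j l) in
    op OpAdd z y).

(* The pivot vv^T joins the store; [p] = p(X'). *)
Definition grow K m n t (A : 'I_m -> 'M[K]_n) (b p : 'cV[K]_m)
    (s : store K m n t) (v : 'cV[K]_n) : prog K n (store K m n t.+1) :=
  let* V := comp_outer v in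
  let* q := comp_image A V in
  let* row := tab (fun i => dot_cV n (img s i) q) in
  let* qq := dot_cV n q q in
  let* bq := dot_cV n b q in
  let* xq := dot_cV n p q in
  let* zero := cst 0 in
  Ret (Store (frcons (vec s) v) (frcons (img s) q)
         (frcons (fun i => frcons (gram s i) (row i)) (frcons row qq))
         (frcons (bimg s) bq) (frcons (ximg s) xq) (frcons (wgt s) zero)
         (wgt0 s) (xx s) (xb s)).

(* How the search chooses, at pass [k], among the stored pivots; [flags] tells
   which of the [t] stored points are pivots.  The rule may be any one that
   finds a pivot whenever there is one. *)
Definition selection := nat -> forall t, ('I_t -> bool) -> option 'I_t.

Definition selection_spec (sel : selection) : Prop :=
  forall k t (flags : 'I_t -> bool),
    match sel k t flags return Prop with
    | Some i => flags i
    | None => forall i, ~~ flags i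
    end.

(* [bb] = |b|^2; [used] lists the stored vectors used as pivots so far. *)
Fixpoint chm_loop K m n (A : 'I_m -> 'M[K]_n) (b : 'cV[K]_m) (eps rad : K)
    (sel : selection) (X0 : 'M[K]_n) (p0 : 'cV[K]_m) (bb : K)
    (fuel k t : nat) (s : store K m n t) (used : seq 'cV[K]_n) :
    prog K n (option (outcome K n * seq 'cV[K]_n * seq 'cV[K]_n)) :=
  match fuel with
  | 0%N => Ret None
  | fuel'.+1 =>
    let vs := [seq vec s i | i <- enum 'I_t] in
    let* d1 := op OpSub (xx s) (xb s) in
    let* d2 := op OpSub bb (xb s) in
    let* d := op OpAdd d1 d2 in
    let* e := op OpMul eps rad in
    let* e2 := op OpMul e e in
    let* stop := leqp d e2 in
    if stop then
      let* X := comp_iterate X0 s in Ret (Some (Approx X, vs, used))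
    else
    (* |b - q|^2 <= |p(X') - q|^2 after cancelling |q|^2, for q = p(V_i) *)
    let* flags := tab (fun i =>
      let* y := op OpSub bb (bimg s i) in
      let* y' := op OpSub y (bimg s i) in
      let* z := op OpSub (xx s) (ximg s i) in
      let* z' := op OpSub z (ximg s i) in
      leqp y' z') in
    match sel k t flags with
    | Some i =>
      let* s' := move_to s i in
      chm_loop A b eps rad sel X0 p0 bb fuel' k.+1 s' (rcons used (vec s i))
    | None =>
      let* p := comp_current p0 s in
      let* r := tab_cV (fun l => op OpSub (p l ord0) (b l ord0)) in
      let* M := comp_gradient A r in
      let* tau := comp_threshold n (xx s) bb in
      let* answer := query M tau in
      match answer with
      | None =>
        let* X := comp_iterate X0 s in Ret (Some (Witness X, vs, used))
      | Some v =>
        let* s' := grow A b p s v in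
        chm_loop A b eps rad sel X0 p0 bb fuel' k.+1 s' used
      end
    end
  end.

(* A completed run returns the output, the generated vectors and the list of
   those used as pivots in the convex hull membership iterations. *)
Definition chm_triangle K m n (A : 'I_m -> 'M[K]_n) (b : 'cV[K]_m)
    (eps rad : K) (sel : selection) (fuel : nat) :
    prog K n (option (outcome K n * seq 'cV[K]_n * seq 'cV[K]_n)) :=
  let* X0 := comp_start K n in
  let* p0 := comp_image A X0 in
  let* xx0 := dot_cV n p0 p0 in
  let* xb0 := dot_cV n p0 b in
  let* bb := dot_cV n b b in
  let* one := cst 1 in
  let s := Store (@ord_elim0 _) (@ord_elim0 _) (@ord_elim0 _) (@ord_elim0 _)
             (@ord_elim0 _) (@ord_elim0 _) one xx0 xb0 in
  chm_loop A b eps rad sel X0 p0 bb fuel 0 s [::].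

Definition num_images (R : realType) m n (A : 'I_m -> 'M[R]_n)
    (vs : seq 'cV[R]_n) : nat :=
  size (undup [seq pimage A (outer v) | v <- vs]).

(* Main.v *)
(* Put d = |p(X) - b|.  Moving from p(X) to the nearest point of the segment
   towards a pivot lowers d^2 by at least d^4 / (16 rad^2), so it raises
   16 rad^2 / d^2 by at least 1, and O(1/eps^2) moves suffice.
   In the CHM-based algorithm a generated pivot has a new image, since no stored
   point is a pivot, and for the same reason the next search can select only
   it: all generated pivots are used, their images are distinct, and N = T.  A
   search with its move costs O(T), a generation O(m n^2 + m T), and there are
   O(1/eps^2) of the former and T of the latter. *)

Require Import Defs.
From HB Require Import structures.
From mathcomp Require Import all_boot all_order all_algebra.
From mathcomp Require Import reals.
From mathcomp Require Import boolp zify ring lra.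

Set Implicit Arguments.
Unset Strict Implicit.
Unset Printing Implicit Defensive.

Import Order.TTheory GRing.Theory Num.Theory.
Local Open Scope ring_scope.

(** Write d = |p(X) - b| and let q be the image of a pivot. The pivot inequality amounts to 2 (b -
    p(X)) . (q - p(X)) >= d^2, and the parallelogram law gives |q - p(X)|^2 <= 4 rad^2. Going a
    fraction c of the way to q therefore changes d^2 by at most 4 rad^2 c^2 - c d^2, and the minimum
    of this bound, at c = d^2 / (8 rad^2), is the stated drop. The obstacle in the CHM-based
    algorithm is that a generation makes no progress in d and leaves in the store a vector not yet
    used. The induction on the remaining moves treats a generation and the move that it forces as
    one step made of two passes, after which the stored and the used vectors again coincide as sets.
    Costs are bounded in terms of the final T, unknown during the run, so each generation is paid
    for by the growth of the store. *)

Definition vdot (R : realType) k (x y : 'cV[R]_k) : R := \sum_i x i 0 * y i 0.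

(** * The Euclidean inner product and norm *)

Section Vdot.
Variables (R : realType) (k : nat).
Implicit Types (x y z : 'cV[R]_k) (a : R).

Lemma vdotC x y : vdot x y = vdot y x.
Proof. by apply: eq_bigr => i _; rewrite mulrC. Qed.

Lemma vdotDl x y z : vdot (x + y) z = vdot x z + vdot y z.
Proof. by rewrite -big_split; apply: eq_bigr => i _; rewrite mxE mulrDl. Qed.

Lemma vdotZl a x y : vdot (a *: x) y = a * vdot x y.
Proof. by rewrite mulr_sumr; apply: eq_bigr => i _; rewrite mxE mulrA. Qed.

Lemma vdotNl x y : vdot (- x) y = - vdot x y.
Proof. by rewrite -scaleN1r vdotZl mulN1r. Qed.

Lemma vdotDr x y z : vdot x (y + z) = vdot x y + vdot x z.
Proof. by rewrite vdotC vdotDl !(vdotC x). Qed.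

Lemma vdotZr a x y : vdot x (a *: y) = a * vdot x y.
Proof. by rewrite vdotC vdotZl (vdotC x). Qed.

Lemma vdotNr x y : vdot x (- y) = - vdot x y.
Proof. by rewrite vdotC vdotNl (vdotC x). Qed.

Definition vdotE := (vdotDl, vdotNl, vdotZl, vdotDr, vdotNr, vdotZr).

Lemma vdot_ge0 x : 0 <= vdot x x.
Proof. by apply: sumr_ge0 => i _; rewrite -expr2 sqr_ge0. Qed.

Lemma norm2E x : norm2 x = Num.sqrt (vdot x x).
Proof. by congr Num.sqrt; apply: eq_bigr => i _; rewrite expr2. Qed.

Lemma norm2_ge0 x : 0 <= norm2 x.
Proof. exact: sqrtr_ge0. Qed.

Lemma norm2_le x y : (norm2 x <= norm2 y) = (vdot x x <= vdot y y).
Proof. by rewrite !norm2E ler_sqrt ?vdot_ge0. Qed.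

Lemma norm2_le_cst x a : 0 <= a -> (norm2 x <= a) = (vdot x x <= a ^+ 2).
Proof.
by move=> a0; rewrite -{1}(ger0_norm a0) -sqrtr_sqr norm2E ler_sqrt ?sqr_ge0.
Qed.

Lemma norm2C x y : norm2 (x - y) = norm2 (y - x).
Proof. by rewrite !norm2E -opprB vdotNl vdotNr opprK. Qed.

Lemma norm2_eq1 x : norm2 x = 1 -> vdot x x = 1.
Proof. by move=> h; rewrite -(sqr_sqrtr (vdot_ge0 x)) -norm2E h expr1n. Qed.

End Vdot.

(** * Points of the spectraplex *)

Section Spectraplex.
Variables (R : realType) (n : nat).
Implicit Types (X Y V : 'M[R]_n).

Lemma spectraplex_outer (v : 'cV[R]_n) : norm2 v = 1 -> spectraplex (outer v).
Proof.
move=> /norm2_eq1 v1; split; last split.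
- rewrite mxtrace_mulC trace_mx11 mxE -[RHS]v1.
  by apply: eq_bigr => i _; rewrite mxE.
- by rewrite trmx_mul trmxK.
- move=> x; rewrite /outer mulmxA -mulmxA.
  have -> : v^T *m x = (x^T *m v)^T by rewrite trmx_mul trmxK.
  by rewrite mxE big_ord1 [_^T _ _]mxE -expr2 sqr_ge0.
Qed.

Lemma spectraplex_conv X V a : spectraplex X -> spectraplex V ->
  0 <= a <= 1 -> spectraplex ((1 - a) *: X + a *: V).
Proof.
move=> [tX [sX pX]] [tV [sV pV]] /andP[a0 a1]; split; last split.
- by rewrite mxtraceD !mxtraceZ tX tV !mulr1 subrK.
- by rewrite linearD !linearZ /= sX sV.
- move=> x; rewrite mulmxDr mulmxDl -!scalemxAr -!scalemxAl mxE.
  by rewrite addr_ge0 // mxE mulr_ge0 ?subr_ge0.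
Qed.

Lemma spectraplex_start : (0 < n)%N -> spectraplex (start R n).
Proof.
move=> n0; split; last split.
- rewrite /mxtrace (eq_bigr (fun=> n%:R^-1)); last by move=> i _; rewrite mxE.
  by rewrite sumr_const card_ord -[_ *+ n]mulr_natr mulVf // pnatr_eq0 -lt0n.
- by apply/matrixP => i j; rewrite !mxE.
- move=> x; rewrite mxE.
  have -> : \sum_j (x^T *m start R n) 0 j * x j 0 =
            n%:R^-1 * (\sum_j x j 0) ^+ 2.
    rewrite expr2 mulr_sumr mulr_sumr; apply: eq_bigr => j _.
    rewrite mulrA; congr (_ * _); rewrite mxE mulr_sumr.
    by apply: eq_bigr => i _; rewrite !mxE mulrC.
  by rewrite mulr_ge0 ?sqr_ge0 // invr_ge0.
Qed.

End Spectraplex.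

(** * Pivots as linear inequalities, and the nearest point of a segment *)

Section Geometry.
Variables (R : realType) (m n : nat) (A : 'I_m -> 'M[R]_n) (b : 'cV[R]_m).
Implicit Types (X V : 'M[R]_n).
Local Notation p := (pimage A).

Lemma pimageD X Y : p (X + Y) = p X + p Y.
Proof. by apply/colP => i; rewrite !mxE /frob mulmxDr mxtraceD. Qed.

Lemma pimageZ a X : p (a *: X) = a *: p X.
Proof. by apply/colP => i; rewrite !mxE /frob -scalemxAr mxtraceZ. Qed.

Lemma pimage0 : p 0 = 0.
Proof. by rewrite -(scale0r 0) pimageZ scale0r. Qed.

Lemma pimage_sum t (F : 'I_t -> 'M[R]_n) : p (\sum_i F i) = \sum_i p (F i).
Proof. exact: (big_morph p pimageD pimage0). Qed.

Definition gap X : R := vdot (p X - b) (p X - b).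

Lemma gap_ge0 X : 0 <= gap X.
Proof. exact: vdot_ge0. Qed.

Lemma approx_solutionE eps rad X : 0 <= eps * rad -> spectraplex X ->
  approx_solution A b eps rad X <-> gap X <= (eps * rad) ^+ 2.
Proof.
move=> er0 sX; rewrite /approx_solution norm2_le_cst //.
by split=> [[]|].
Qed.

(** Squared distances with |p(V)|^2 cancelled, associated exactly as in the test that [chm_loop]
    applies to the stored points. *)
Definition is_pivot X V : bool :=
  vdot b b - vdot b (p V) - vdot b (p V) <=
  vdot (p X) (p X) - vdot (p X) (p V) - vdot (p X) (p V).

Lemma pivotE X V : spectraplex V -> pivot A b X V <-> is_pivot X V.
Proof.
move=> sV; rewrite /pivot norm2_le.
have -> : (vdot (b - p V) (b - p V) <= vdot (p X - p V) (p X - p V)) =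
          is_pivot X V.
  rewrite /is_pivot !vdotE (vdotC (p V) b) (vdotC (p V) (p X)).
  by apply/idP/idP => ?; lra.
by split=> [[]|].
Qed.

Definition gradient X : 'M[R]_n := \sum_i (p X - b) i 0 *: A i.

Definition threshold X : R := (vdot (p X) (p X) - vdot b b) / 2.

Lemma frob_gradient X V : frob (gradient X) V = vdot (p X - b) (p V).
Proof.
rewrite /frob /gradient mulmx_suml raddf_sum; apply: eq_bigr => i _ /=.
by rewrite -scalemxAl mxtraceZ [X in _ = _ * X]mxE.
Qed.

(** This reduces the pivot search to what the power method decides: after the cancellation of
    |p(V)|^2 the condition is linear in [V], with matrix [gradient X]. *)
Lemma is_pivot_gradient X V :
  is_pivot X V = (frob (gradient X) V <= threshold X).
Proof.
rewrite frob_gradient /is_pivot /threshold !vdotE.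
by apply/idP/idP => ?; lra.
Qed.

Lemma gradient_sym X : (forall i, (A i)^T = A i) -> (gradient X)^T = gradient X.
Proof.
move=> symA; rewrite /gradient raddf_sum; apply: eq_bigr => i _ /=.
by rewrite linearZ /= symA.
Qed.

Definition step_size (xx xq qq xb bq : R) : R :=
  let s := bq - xb + (xx - xq) in
  let l := xx - xq + (qq - xq) in
  if s <= 0 then 0 else if l <= s then 1 else s / l.

Definition step X V :=
  step_size (vdot (p X) (p X)) (vdot (p X) (p V)) (vdot (p V) (p V))
            (vdot (p X) b) (vdot b (p V)).

Lemma segment_dist (x q : 'cV[R]_m) a :
  vdot ((1 - a) *: x + a *: q - b) ((1 - a) *: x + a *: q - b) =
  vdot (x - b) (x - b) - 2 * a * vdot (b - x) (q - x)
  + a ^+ 2 * vdot (q - x) (q - x).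
Proof.
by rewrite !vdotE (vdotC q x) (vdotC q b) (vdotC x b); ring.
Qed.

(** Along the segment the squared distance is f(a) = f(0) - 2 a s + a^2 l. In each of the three
    cases of the clamping, f(a) minus the claimed minimum is an explicit nonnegative expression. *)
Lemma step_spec X V :
  0 <= step X V <= 1 /\
  nearest_step A b X V ((1 - step X V) *: X + step X V *: V).
Proof.
pose s := vdot (b - p X) (p V - p X).
pose l := vdot (p V - p X) (p V - p X).
have l0 : 0 <= l by exact: vdot_ge0.
have stepE : step X V = if s <= 0 then 0 else if l <= s then 1 else s / l.
  have -> : s = vdot b (p V) - vdot (p X) b
                + (vdot (p X) (p X) - vdot (p X) (p V)).
    by rewrite /s !vdotE (vdotC (p X) b); ring.
  have -> // : l = vdot (p X) (p X) - vdot (p X) (p V)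
                + (vdot (p V) (p V) - vdot (p X) (p V)).
  by rewrite /l !vdotE (vdotC (p V) (p X)); ring.
have step01 : 0 <= step X V <= 1.
  rewrite stepE; case: ifP => [_|/negbT]; first by rewrite lexx ler01.
  rewrite -ltNge => s0; case: ifP => [_|/negbT]; first by rewrite lexx ler01.
  rewrite -ltNge => sl; have l1 : 0 < l by lra.
  by rewrite divr_ge0 ?(ltW s0) //= ler_pdivrMr // mul1r ltW.
split=> //; exists (step X V); split=> // a /andP[a0 a1].
rewrite norm2_le !segment_dist -/s -/l stepE.
case: ifP => [s0|/negbT].
  have as0 : a * s <= 0 by rewrite mulr_ge0_le0.
  have al0 : 0 <= a ^+ 2 * l by rewrite mulr_ge0 ?sqr_ge0.
  lra.
rewrite -ltNge => s0; case: ifP => [sl|/negbT].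
  have as0 : 0 <= (1 - a) * (s - l) by rewrite mulr_ge0 ?subr_ge0.
  have al0 : 0 <= (1 - a) ^+ 2 * l by rewrite mulr_ge0 ?sqr_ge0.
  lra.
(* The quotient s / l is used only when 0 < s < l, so it never divides by zero; here f(a) - f(c) = l
   (a - c)^2. *)
rewrite -ltNge => sl; have l1 : 0 < l by lra.
set c := s / l; have -> : s = c * l by rewrite /c divfK ?gt_eqF.
suff : 0 <= l * (a - c) ^+ 2 by lra.
by rewrite mulr_ge0 ?sqr_ge0.
Qed.

Lemma spectraplex_nearest X V X' : spectraplex X -> spectraplex V ->
  nearest_step A b X V X' -> spectraplex X'.
Proof. by move=> sX sV [a [a01 -> _]]; exact: spectraplex_conv. Qed.

End Geometry.

(** * Decrease of the gap and the number of moves *)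

Section Progress.
Variables (R : realType) (m n : nat) (A : 'I_m -> 'M[R]_n) (b : 'cV[R]_m).
Variables (eps rad : R).
Hypothesis eps01 : 0 < eps < 1.
Hypothesis radP : is_radius A b rad.
Implicit Types (X V : 'M[R]_n).
Local Notation p := (pimage A).
Local Notation gap := (gap A b).

Lemma rad_ge0 : 0 <= rad.
Proof. by case: radP => -[X [_ <-]] _; exact: norm2_ge0. Qed.

Lemma tol_ge0 : 0 <= eps * rad.
Proof. by rewrite mulr_ge0 ?rad_ge0 //; case/andP: eps01 => /ltW. Qed.

Lemma gap_le X : spectraplex X -> gap X <= rad ^+ 2.
Proof.
move=> sX; rewrite -norm2_le_cst ?rad_ge0 // norm2C.
by case: radP => _; apply.
Qed.

Lemma not_approx_gap X : spectraplex X -> ~ approx_solution A b eps rad X ->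
  (eps * rad) ^+ 2 < gap X.
Proof.
move=> sX nX; rewrite ltNge; apply/negP => h; apply: nX.
by apply/approx_solutionE => //; exact: tol_ge0.
Qed.

(* The step length [gap X / (8 rad^2)] is not optimal, but the optimal one does
   at least as well. *)
Lemma gap_step X V X' : spectraplex X -> 0 < rad -> pivot A b X V ->
  nearest_step A b X V X' ->
  gap X' <= gap X - gap X ^+ 2 / (16 * rad ^+ 2).
Proof.
move=> sX rad0 [sV piv] [a [a01 -> near]].
have gX := gap_le sX; have gV := gap_le sV; have g0 := gap_ge0 A b X.
have r2 : 0 < rad ^+ 2 by rewrite exprn_gt0.
pose c := gap X / (8 * rad ^+ 2).
have c01 : 0 <= c <= 1.
  rewrite divr_ge0 ?ler_pdivrMr; lra.
have := near _ c01; rewrite norm2_le.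
rewrite {1}/gap pimageD !pimageZ => /le_trans; apply.
move: piv; rewrite norm2_le => piv.
have lV : vdot (p V - p X) (p V - p X) <= 4 * rad ^+ 2.
  have := vdot_ge0 ((p V - b) + (p X - b)).
  have -> : p V - p X = (p V - b) - (p X - b) by rewrite opprB addrA subrK.
  move: gX gV; rewrite /gap; move: (p V - b) (p X - b) => u w.
  rewrite !vdotE (vdotC w u); lra.
have sV2 : gap X <= 2 * vdot (b - p X) (p V - p X).
  move: piv; rewrite /gap !vdotE (vdotC (p V) b) (vdotC (p V) (p X)).
  by rewrite (vdotC (p X) b); lra.
rewrite segment_dist -/(gap X).
have -> : gap X ^+ 2 / (16 * rad ^+ 2) = 4 * rad ^+ 2 * c ^+ 2.
  by rewrite /c; field; rewrite gt_eqF.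
have : c * gap X = 8 * rad ^+ 2 * c ^+ 2.
  by rewrite /c; field; rewrite gt_eqF.
case/andP: c01 => c0 c1.
have := ler_wpM2l c0 sV2.
have := ler_wpM2l (sqr_ge0 c) lV.
lra.
Qed.

(* At most [F] more nearest steps can be made from [X]: each of them raises
   [16 rad^2 / gap X] by at least [1]. *)
Definition within (F : nat) X : Prop :=
  approx_solution A b eps rad X \/
  16 / eps ^+ 2 < 16 * rad ^+ 2 / gap X + F%:R.

Lemma within0 X : spectraplex X -> within 0 X -> approx_solution A b eps rad X.
Proof.
move=> sX [//|]; rewrite addr0 => h.
apply/approx_solutionE => //; first exact: tol_ge0.
rewrite leNgt; apply/negP => gX; move: h; apply/negP; rewrite -leNgt.
have g0 : 0 < gap X by apply: le_lt_trans gX; rewrite sqr_ge0.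
case/andP: eps01 => e0 _.
rewrite -!(mulrA 16) ler_pM2l // ler_pdivrMr // mulrC.
by rewrite ler_pdivlMr ?exprn_gt0 // -exprMn mulrC ltW.
Qed.

Lemma within_step F X V X' : spectraplex X ->
  ~ approx_solution A b eps rad X -> pivot A b X V ->
  nearest_step A b X V X' -> within F.+1 X -> within F X'.
Proof.
move=> sX nX piv near [//|bnd].
have sX' : spectraplex X' by apply: spectraplex_nearest near; case: piv.
(* A move may reach [b] exactly. Then [gap X'] is 0 and the quotient by it is 0 by convention; the
   first disjunct of [within] covers this case. *)
have [g'X|nX'] := leP (gap X') ((eps * rad) ^+ 2).
  by left; apply/approx_solutionE => //; exact: tol_ge0.
right; apply: (lt_le_trans bnd).
have gX := not_approx_gap sX nX.
have g0 : 0 < gap X by apply: le_lt_trans gX; rewrite sqr_ge0.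
have g'0 : 0 < gap X' by apply: le_lt_trans nX'; rewrite sqr_ge0.
have r0 : 0 < rad.
  rewrite lt_neqAle rad_ge0 andbT; apply: contraTneq g0 => r0.
  by rewrite -leNgt (le_trans (gap_le sX)) // -r0 expr0n.
have r2 : 0 < rad ^+ 2 by rewrite exprn_gt0.
have st := gap_step sX r0 piv near.
rewrite -(natr1 F) [F%:R + 1]addrC addrA lerD2r.
move: (gap X) (gap X') (rad ^+ 2) g0 g'0 r2 st => g g' r g0 g'0 r0' st.
(* This is 16 r / g' >= 16 r / g + 1 with the denominators cleared; it follows from (g - g^2 / (16
   r)) (16 r + g) = 16 r g - g^3 / (16 r). *)
have : g' * (16 * r + g) <= 16 * r * g.
  have gg : 0 <= 16 * r + g by lra.
  apply: (le_trans (ler_wpM2r gg st)).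
  have -> : (g - g ^+ 2 / (16 * r)) * (16 * r + g) =
            16 * r * g - g ^+ 3 / (16 * r) by field; rewrite gt_eqF.
  by rewrite gerBl divr_ge0 ?exprn_ge0 ?ltW //; lra.
rewrite -ler_pdivrMr // => h.
have -> : 16 * r / g + 1 = (16 * r + g) / g by field; rewrite gt_eqF.
rewrite ler_pdivrMr // mulrAC ler_pdivlMr // mulrC.
move: h; rewrite ler_pdivrMr //; lra.
Qed.

Lemma within_start X : spectraplex X ->
  exists2 F : nat, within F X & F%:R <= 17 / eps ^+ 2.
Proof.
(* The quotient by the gap enters only as a nonnegative number, which holds also for a zero gap.
   Rounding up costs at most 1 <= 1 / eps^2, whence 17 instead of 16. *)
move=> sX; exists (Num.truncn (16 / eps ^+ 2)).+1.
  right; apply: (lt_le_trans (truncnS_gt _)).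
  by rewrite lerDr divr_ge0 ?gap_ge0 // mulr_ge0 ?sqr_ge0.
have e2 : 1 <= 1 / eps ^+ 2.
  case/andP: eps01 => e0 e1.
  by rewrite ler_pdivlMr ?exprn_gt0 // mul1r exprn_ile1 ?ltW.
have t0 : (Num.truncn (16 / eps ^+ 2))%:R <= 16 / eps ^+ 2.
  by rewrite truncn_le; lra.
by rewrite -(natr1 (Num.truncn _)); lra.
Qed.

End Progress.

(** * Operation counts of the elementary programs *)

Section Cost.
Variables (R : realType) (n : nat) (oracle : 'M[R]_n -> R -> option 'cV[R]_n).

(** The value is exact but the cost is only bounded, so that branches of unequal length, as in
    [comp_step], share one figure. *)
Definition computes T (p : prog R n T) (c : nat) (x : T) : Prop :=
  ((run oracle p).1 <= c)%N /\ (run oracle p).2 = x.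

Lemma run_bind T U (p : prog R n T) (f : T -> prog R n U) :
  run oracle (bind p f) =
  (((run oracle p).1 + (run oracle (f (run oracle p).2)).1)%N,
   (run oracle (f (run oracle p).2)).2).
Proof.
elim: p => [x|c k IH|o x y k IH|x y k IH|M t k IH] /=; rewrite ?IH ?addSn //.
by case: (run _ (f x)).
Qed.

Lemma computes_bind T U (p : prog R n T) (f : T -> prog R n U) c x c' y :
  computes p c x -> computes (f x) c' y -> computes (bind p f) (c + c') y.
Proof.
move=> [cp vp] [cf vf]; rewrite /computes run_bind vp; split=> //.
exact: leq_add.
Qed.

Lemma computes_le T (p : prog R n T) c c' x :
  computes p c x -> (c <= c')%N -> computes p c' x.
Proof. by move=> [cp vp] cc'; split=> //; exact: leq_trans cc'. Qed.

Lemma computes_val T (p : prog R n T) c x y :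
  computes p c x -> x = y -> computes p c y.
Proof. by move=> h <-. Qed.

Lemma computes_ret T (x : T) : computes (Ret x) 0 x.
Proof. by []. Qed.

Lemma computes_op o x y : computes (op o x y) 1 (arith_fun o x y).
Proof. by []. Qed.

Lemma computes_cst c : computes (cst c) 1 c%:R.
Proof. by []. Qed.

Lemma computes_leqp x y : computes (leqp x y) 1 (x <= y).
Proof. by []. Qed.

Lemma computes_query M t : computes (query M t) 0 (oracle M t).
Proof. by []. Qed.

Lemma fcons_eta T k (f : 'I_k.+1 -> T) :
  fcons (f ord0) (fun i => f (lift ord0 i)) = f.
Proof. by apply: funext => i; rewrite /fcons; case: unliftP => [j|] ->. Qed.

Lemma computes_tab T k (f : 'I_k -> prog R n T) c g :
  (forall i, computes (f i) c (g i)) -> computes (tab f) (k * c) g.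
Proof.
elim: k f g => [|k IH] f g fP.
  by split=> //=; apply: funext => -[].
rewrite mulSn; eapply computes_bind; first exact: fP.
rewrite -[(k * c)%N]addn0; eapply computes_bind.
  by apply: IH => i; exact: fP.
by split=> //=; exact: (fcons_eta g).
Qed.

Lemma computes_tab_cV k (f : 'I_k -> prog R n R) c (g : 'cV[R]_k) :
  (forall i, computes (f i) c (g i 0)) -> computes (tab_cV f) (k * c) g.
Proof.
move=> fP; rewrite -[(k * c)%N]addn0.
eapply computes_bind; first exact: (computes_tab fP).
by split=> //=; apply/colP => i; rewrite mxE.
Qed.

Lemma computes_tab_mx k (f : 'I_k -> 'I_k -> prog R n R) c (g : 'M[R]_k) :
  (forall i j, computes (f i j) c (g i j)) ->
  computes (tab_mx f) (k * (k * c)) g.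
Proof.
move=> fP; rewrite -[(k * _)%N]addn0; eapply computes_bind.
  by apply: computes_tab => i; apply: computes_tab; exact: fP.
by split=> //=; apply/matrixP => i j; rewrite mxE.
Qed.

Lemma computes_sum k (x : 'I_k -> R) : computes (sum_fun n x) k.+1 (\sum_i x i).
Proof.
elim: k x => [|k IH] x; first by rewrite big_ord0.
rewrite big_ord_recl; apply: computes_le (_ : k.+1 + 1 <= _)%N; last by lia.
by eapply computes_bind; [exact: IH | exact: computes_op].
Qed.

Lemma computes_dot k (x y : 'I_k -> R) :
  computes (dot n x y) (2 * k + 1) (\sum_i x i * y i).
Proof.
have -> : (2 * k + 1 = k * 1 + k.+1)%N by lia.
eapply computes_bind; last exact: computes_sum.
by apply: computes_tab => i; exact: computes_op.
Qed.

Lemma computes_dot_cV k (x y : 'cV[R]_k) :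
  computes (dot_cV n x y) (2 * k + 1) (vdot x y).
Proof. exact: computes_dot. Qed.

Lemma computes_frob (X Y : 'M[R]_n) :
  computes (comp_frob X Y) (2 * n ^ 2 + 2 * n + 1) (frob X Y).
Proof.
have -> : (2 * n ^ 2 + 2 * n + 1 = n * (2 * n + 1) + n.+1)%N by lia.
have -> : frob X Y = \sum_i \sum_j X i j * Y j i.
  by rewrite /frob /mxtrace; apply: eq_bigr => i _; rewrite mxE.
eapply computes_bind; last exact: computes_sum.
by apply: computes_tab => i; exact: computes_dot.
Qed.

Lemma computes_image m (A : 'I_m -> 'M[R]_n) X :
  computes (comp_image A X) (m * (2 * n ^ 2 + 2 * n + 1)) (pimage A X).
Proof.
by apply: computes_tab_cV => i; rewrite mxE; exact: computes_frob.
Qed.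

Lemma computes_outer (v : 'cV[R]_n) : computes (comp_outer v) (n ^ 2) (outer v).
Proof.
have -> : (n ^ 2 = n * (n * 1))%N by lia.
apply: computes_tab_mx => i j.
by rewrite mxE big_ord1 mxE; exact: computes_op.
Qed.

Lemma computes_start : computes (comp_start R n) 3 (start R n).
Proof. by split=> //=; rewrite div1r. Qed.

Lemma computes_gradient m (A : 'I_m -> 'M[R]_n) b X :
  computes (comp_gradient A (pimage A X - b)) (n * (n * (2 * m + 1)))
    (gradient A b X).
Proof.
apply: computes_tab_mx => j l; rewrite summxE.
under eq_bigr do rewrite mxE.
exact: computes_dot.
Qed.

Lemma computes_threshold m (A : 'I_m -> 'M[R]_n) b X :
  computes (comp_threshold n (vdot (pimage A X) (pimage A X)) (vdot b b)) 3
    (threshold A b X).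
Proof. by []. Qed.

Lemma computes_step (xx xq qq xb bq : R) :
  computes (comp_step n xx xq qq xb bq) 10 (step_size xx xq qq xb bq).
Proof.
rewrite /step_size /computes /=.
by case: ifP => _ //=; case: ifP.
Qed.

Lemma computes_residual m (x b : 'cV[R]_m) :
  computes (tab_cV (fun i => op OpSub (x i ord0) (b i ord0))) m (x - b).
Proof.
apply: computes_le (_ : m * 1 <= _)%N; last by lia.
apply: computes_tab_cV => i.
by rewrite !mxE; exact: computes_op.
Qed.

End Cost.

(** Symbolic execution of one instruction. After [eapply computes_le] the total cost is an
    existential variable that the chain of calls fills with a sum, and arithmetic compares it with
    the announced bound at the end. *)
Ltac computes_by H := eapply computes_bind; [exact: H | lazy beta].


(** All lower-order terms of a count are absorbed into m n^2 by these inequalities. *)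
Lemma dims_le m n : (0 < m)%N -> (0 < n)%N ->
  [/\ 1 <= m * n ^ 2, m <= m * n ^ 2, n ^ 2 <= m * n ^ 2 &
      m * n <= m * n ^ 2]%N.
Proof. by move=> m0 n0; split; nia. Qed.


(** * The store of the CHM-based algorithm and its updates *)

Lemma frcons_max k T (f : 'I_k -> T) x : frcons f x ord_max = x.
Proof. by rewrite /frcons unlift_none. Qed.

Lemma frcons_lift k T (f : 'I_k -> T) x i : frcons f x (lift ord_max i) = f i.
Proof. by rewrite /frcons liftK. Qed.

Lemma widen_lift_max k (i : 'I_k) : widen_ord (leqnSn k) i = lift ord_max i.
Proof. by apply: ord_inj; rewrite lift_max. Qed.


Section Store.
Variables (R : realType) (m n : nat) (A : 'I_m -> 'M[R]_n) (b : 'cV[R]_m).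
Variable oracle : 'M[R]_n -> R -> option 'cV[R]_n.
Local Notation p := (pimage A).
Local Notation computes := (computes oracle).

Lemma computes_conv (a : R) (X V : 'M[R]_n) :
  computes (tab_mx (fun i j =>
        let* y := op OpMul (1 - a) (X i j) in
        let* z := op OpMul a (V i j) in
        op OpAdd y z)) (3 * n ^ 2) ((1 - a) *: X + a *: V).
Proof.
apply: computes_le (_ : n * (n * 3) <= _)%N; last by lia.
by apply: computes_tab_mx => i j; rewrite !mxE.
Qed.

(** The invariant that ties the cached numbers to an iterate [X] which the loop never forms.
    Membership of [X] in the spectraplex is carried separately, by [spectraplex_nearest]. *)
Record represents t (s : store R m n t) (X : 'M[R]_n) : Prop := Represents {
  vec_norm : forall i, norm2 (vec s i) = 1;
  imgE : forall i, img s i = p (outer (vec s i));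
  gramE : forall i j,
    gram s i j = vdot (p (outer (vec s i))) (p (outer (vec s j)));
  bimgE : forall i, bimg s i = vdot b (p (outer (vec s i)));
  ximgE : forall i, ximg s i = vdot (p X) (p (outer (vec s i)));
  iterateE : X = wgt0 s *: start R n + \sum_i wgt s i *: outer (vec s i);
  xxE : xx s = vdot (p X) (p X);
  xbE : xb s = vdot (p X) b }.

Definition stored t (s : store R m n t) := [seq vec s i | i <- enum 'I_t].

Lemma computes_move_to t (s : store R m n t) X i :
  represents s X ->
  let a := step A b X (outer (vec s i)) in
  exists s', [/\ computes (move_to s i) (30 * t) s',
    represents s' ((1 - a) *: X + a *: outer (vec s i)) & vec s' = vec s].
Proof.
case=> [N I G B XI X_E XX XB] a.
(* The index [i] witnesses a nonempty store, so the constant part of the cost fits into a multiple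
   of [t]. *)
have t0 : (0 < t)%N by case: (i) => j; lia.
have aE : step_size (xx s) (ximg s i) (gram s i i) (xb s) (bimg s i) = a.
  by rewrite XX XI G XB B.
pose c := 1 - a.
pose X' := c *: X + a *: outer (vec s i).
pose ximg' j := c * ximg s j + a * gram s i j.
eexists; split.
- eapply computes_le.
    rewrite /move_to.
    eapply computes_bind; first exact: computes_val (computes_step _ _ _ _ _ _)
      aE.
    lazy beta; computes_by computes_cst; computes_by computes_op.
    lazy zeta.
    eapply computes_bind.
      by apply: (@computes_tab _ _ _ _ _ _ 3 ximg') => j.
    lazy beta; eapply computes_bind.
      apply: (@computes_tab _ _ _ _ _ _ 2
        (fun j => if j == i then c * wgt s j + a else c * wgt s j)) => j.
      by case: (j == i).
    lazy beta; computes_by computes_op.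
    eapply computes_bind.
      by instantiate (2 := 3%N); instantiate (1 := c * xx s + a * ximg s i).
    lazy beta; eapply computes_bind.
      by instantiate (2 := 3%N);
        instantiate (1 := c * (c * xx s + a * ximg s i) + a * ximg' i).
    lazy beta; eapply computes_bind.
      by instantiate (2 := 3%N); instantiate (1 := c * xb s + a * bimg s i).
    exact: computes_ret.
  lia.
- rewrite -/c -/X'; split=> //=.
  + by move=> j; rewrite /ximg' /X' pimageD !pimageZ !vdotE XI G.
  + rewrite {1}/X' {1}X_E scalerDr scalerA -addrA; congr (_ + _).
    rewrite scaler_sumr (bigD1 i) //= [RHS](bigD1 i) //= eqxx.
    rewrite addrAC scalerA -scalerDl; congr (_ + _).
    by apply: eq_bigr => j /negbTE ->; rewrite scalerA.
  + rewrite /ximg' /X' pimageD !pimageZ !vdotE XX XI G.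
    by rewrite (vdotC (p (outer _)) (p X)); ring.
  + by rewrite /X' pimageD !pimageZ !vdotE XB B (vdotC b).
- by [].
Qed.

Lemma computes_current t (s : store R m n t) X : represents s X ->
  computes (comp_current (p (start R n)) s) (m * (2 * t + 3)) (p X).
Proof.
case=> [N I G B XI X_E XX XB].
apply: computes_tab_cV => l.
apply: computes_le (_ : 2 * t + 1 + (1 + 1) <= _)%N.
  computes_by computes_dot; computes_by computes_op.
  apply: computes_val (computes_op _ _ _ _) _.
  rewrite X_E pimageD pimageZ pimage_sum !mxE summxE /=; congr (_ + _).
  by apply: eq_bigr => i _; rewrite I pimageZ !mxE.
by lia.
Qed.

(** The matrix is assembled only for the output, so its O(n^2 t) cost is paid once. *)
Lemma computes_iterate t (s : store R m n t) X : represents s X ->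
  computes (comp_iterate (start R n) s) (3 * n ^ 2 * t.+1) X.
Proof.
case=> [N I G B XI X_E XX XB].
apply: computes_le (_ : t * n ^ 2 + n * (n * (2 * t + 1 + (1 + 1))) <= _)%N.
  eapply computes_bind.
    by apply: computes_tab => i; exact: computes_outer.
  lazy beta; apply: computes_tab_mx => j l.
  computes_by computes_dot; computes_by computes_op.
  apply: computes_val (computes_op _ _ _ _) _.
  rewrite X_E !mxE summxE /=; congr (_ + _).
  by apply: eq_bigr => i _; rewrite [RHS]mxE.
by nia.
Qed.

Lemma stored_frcons t (s : store R m n t) (s' : store R m n t.+1) v :
  vec s' = frcons (vec s) v -> stored s' = rcons (stored s) v.
Proof.
move=> E; rewrite /stored E enum_ordSr map_rcons frcons_max -map_comp.
by congr rcons; apply: eq_map => i /=; rewrite widen_lift_max frcons_lift.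
Qed.

(** The new pivot enters with weight 0, so the same [X] stays represented. Only the inner products
    with the new image are computed, hence m t in place of a full Gram matrix. *)
Lemma computes_grow t (s : store R m n t) X v : represents s X ->
  norm2 v = 1 -> (0 < m)%N -> (0 < n)%N ->
  exists s', [/\ computes (grow A b (p X) s v) (20 * (m * n ^ 2 + m * t)) s',
    represents s' X & vec s' = frcons (vec s) v].
Proof.
case=> [N I G B XI X_E XX XB] v1 m_gt0 n_gt0.
have [s1 s2 s3 s4] := dims_le m_gt0 n_gt0.
eexists; split.
- eapply computes_le.
    rewrite /grow.
    computes_by computes_outer; computes_by computes_image.
    eapply computes_bind.
      by apply: computes_tab => i; exact: computes_dot_cV.
    lazy beta.
    computes_by computes_dot_cV; computes_by computes_dot_cV.
    computes_by computes_dot_cV; computes_by computes_cst.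
    exact: computes_ret.
  have : (t <= m * t)%N by nia.
  lia.
- split=> //=.
  + by move=> i; case: (unliftP ord_max i) => [j|] ->;
      rewrite ?frcons_lift ?frcons_max.
  + by move=> i; case: (unliftP ord_max i) => [j|] ->;
      rewrite ?frcons_lift ?frcons_max.
  + move=> i j; case: (unliftP ord_max i) => [i'|] ->;
      case: (unliftP ord_max j) => [j'|] ->;
      by rewrite ?frcons_lift ?frcons_max ?frcons_lift ?frcons_max ?I // vdotC.
  + by move=> i; case: (unliftP ord_max i) => [j|] ->;
      rewrite ?frcons_lift ?frcons_max.
  + by move=> i; case: (unliftP ord_max i) => [j|] ->;
      rewrite ?frcons_lift ?frcons_max.
  + rewrite big_ord_recr /= !frcons_max scale0r addr0 {1}X_E; congr (_ + _).
    by apply: eq_bigr => i _; rewrite widen_lift_max !frcons_lift.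
- by [].
Qed.

End Store.

(** Bookkeeping for the two inductive steps of [chm_loop_spec]: K is m n^2, M is m, T the final
    store size, U the number of later moves, E the cost of the last pass. A move is charged 41 T; in
    [generate_cost] the generation is paid for by the increase of [t] in the left-hand charge. *)
Lemma stored_cost K M t T U c E : (t <= T)%N ->
  (c + 60 * t * (K + M * T) <= 41 * U * T + 60 * T * (K + M * T) + E)%N ->
  (41 * t + c + 60 * t * (K + M * T) <=
   41 * U.+1 * T + 60 * T * (K + M * T) + E)%N.
Proof. by lia. Qed.

Lemma generate_cost K M t T U c E : (t < T)%N ->
  (c + 60 * t.+1 * (K + M * T) <= 41 * U * T + 60 * T * (K + M * T) + E)%N ->
  (60 * (K + M * t) + (41 * t.+1 + c) + 60 * t * (K + M * T) <=
   41 * U.+1 * T + 60 * T * (K + M * T) + E)%N.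
Proof.
move=> tT; have : (M * t <= M * T)%N by rewrite leq_mul2l ltnW ?orbT.
by lia.
Qed.

(** * Passes of the two loops and their iteration *)

Section Algorithms.
Variables (R : realType) (m n : nat) (A : 'I_m -> 'M[R]_n) (b : 'cV[R]_m).
Variables (eps rad : R) (oracle : 'M[R]_n -> R -> option 'cV[R]_n).
Hypotheses (m_gt0 : (0 < m)%N) (n_gt0 : (0 < n)%N).
Hypothesis symA : forall i, (A i)^T = A i.
Hypothesis eps01 : 0 < eps < 1.
Hypothesis radP : is_radius A b rad.
Hypothesis oracleP : power_method_spec oracle.
Local Notation p := (pimage A).
Local Notation computes := (computes oracle).
Local Notation represents := (represents A b).

Lemma oracle_pivot X v :
  oracle (gradient A b X) (threshold A b X) = Some v -> rank_one_pivot A b X v.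
Proof.
move=> E; have := oracleP (threshold A b X) (gradient_sym b X symA).
rewrite E -is_pivot_gradient => -[v1 piv].
by split=> //; apply/pivotE => //; exact: spectraplex_outer.
Qed.

Lemma oracle_witness X : spectraplex X ->
  oracle (gradient A b X) (threshold A b X) = None -> witness A b X.
Proof.
move=> sX E; have := oracleP (threshold A b X) (gradient_sym b X symA).
rewrite E => wit; split=> // V piv; have sV := piv.1.
move: piv => /(pivotE A b X sV).
by rewrite is_pivot_gradient leNgt wit.
Qed.

Lemma approx_test X : spectraplex X ->
  (gap A b X <= eps * rad * (eps * rad)) <-> approx_solution A b eps rad X.
Proof.
move=> sX; rewrite -expr2; symmetry; apply: approx_solutionE => //.
exact: (tol_ge0 eps01 radP).
Qed.

Lemma spectrahull_loop_stop fuel X vs :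
  approx_solution A b eps rad X ->
  computes (spectrahull_loop A b eps rad fuel.+1 X vs) (60 * (m * n ^ 2))
    (Some (Approx X, vs)).
Proof.
move=> aX; have [s1 s2 s3 s4] := dims_le m_gt0 n_gt0.
have /approx_test gX := aX; have {}gX := gX aX.1.
eapply computes_le.
  cbn [spectrahull_loop]; computes_by computes_image.
  computes_by computes_residual; computes_by computes_dot_cV.
  computes_by computes_op; computes_by computes_op.
  eapply computes_bind; first exact: computes_val (computes_leqp _ _ _) gX.
  exact: computes_ret.
lia.
Qed.

Lemma spectrahull_loop_witness fuel X vs : spectraplex X ->
  ~ approx_solution A b eps rad X ->
  oracle (gradient A b X) (threshold A b X) = None ->
  computes (spectrahull_loop A b eps rad fuel.+1 X vs) (60 * (m * n ^ 2))
    (Some (Witness X, vs)).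
Proof.
move=> sX naX E; have [s1 s2 s3 s4] := dims_le m_gt0 n_gt0.
have gX : (gap A b X <= eps * rad * (eps * rad)) = false.
  by apply/negP => /(approx_test sX).
eapply computes_le.
  cbn [spectrahull_loop]; computes_by computes_image.
  computes_by computes_residual; computes_by computes_dot_cV.
  computes_by computes_op; computes_by computes_op.
  eapply computes_bind; first exact: computes_val (computes_leqp _ _ _) gX.
  lazy beta iota; computes_by computes_gradient.
  computes_by computes_dot_cV; computes_by computes_dot_cV.
  computes_by computes_threshold.
  eapply computes_bind; first exact: computes_val (computes_query _ _ _) E.
  exact: computes_ret.
lia.
Qed.

(** The two images and the gradient are the terms of order m n^2; 60 rounds up the sum of all
    counts. The cost of the remaining passes is a hypothesis, to be supplied by induction. *)
Lemma spectrahull_loop_step fuel X vs v c res : spectraplex X ->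
  ~ approx_solution A b eps rad X ->
  oracle (gradient A b X) (threshold A b X) = Some v ->
  let a := step A b X (outer v) in
  computes (spectrahull_loop A b eps rad fuel
              ((1 - a) *: X + a *: outer v) (rcons vs v)) c res ->
  computes (spectrahull_loop A b eps rad fuel.+1 X vs)
    (60 * (m * n ^ 2) + c) res.
Proof.
move=> sX naX E a rest; have [s1 s2 s3 s4] := dims_le m_gt0 n_gt0.
have gX : (gap A b X <= eps * rad * (eps * rad)) = false.
  by apply/negP => /(approx_test sX).
eapply computes_le.
  cbn [spectrahull_loop]; computes_by computes_image.
  computes_by computes_residual; computes_by computes_dot_cV.
  computes_by computes_op; computes_by computes_op.
  eapply computes_bind; first exact: computes_val (computes_leqp _ _ _) gX.
  lazy beta iota; computes_by computes_gradient.
  computes_by computes_dot_cV; computes_by computes_dot_cV.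
  computes_by computes_threshold.
  eapply computes_bind; first exact: computes_val (computes_query _ _ _) E.
  lazy beta iota; computes_by computes_outer; computes_by computes_image.
  computes_by computes_dot_cV; computes_by computes_dot_cV.
  computes_by computes_dot_cV; computes_by computes_dot_cV.
  computes_by computes_step; computes_by computes_cst; computes_by computes_op.
  eapply computes_bind; first exact: computes_conv.
  exact: rest.
lia.
Qed.

(** [F] moves need [F.+1] passes, since the approximate solution reached by the last move is
    recognized only in the next pass. *)
Lemma spectrahull_loop_spec F X vs : spectraplex X -> within A b eps rad F X ->
  exists out vs',
  [/\ computes (spectrahull_loop A b eps rad F.+1 X vs)
        (60 * (m * n ^ 2) * (size vs').+1) (Some (out, vs ++ vs')),
      spectrahull_exec A b eps rad X vs' out & (size vs' <= F)%N].
Proof.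
elim: F X vs => [|F IH] X vs sX wX.
  have aX := within0 eps01 radP sX wX.
  exists (Approx X), [::]; split=> //; last exact: Sp_approx.
  by rewrite cats0 muln1; exact: spectrahull_loop_stop.
have [aX|naX] := pselect (approx_solution A b eps rad X).
  exists (Approx X), [::]; split=> //; last exact: Sp_approx.
  by rewrite cats0 muln1; exact: spectrahull_loop_stop.
case E: (oracle (gradient A b X) (threshold A b X)) => [v|]; last first.
  exists (Witness X), [::]; split=> //.
    by rewrite cats0 muln1; exact: spectrahull_loop_witness.
  by apply: Sp_witness => //; exact: oracle_witness.
have pv := oracle_pivot E; have [a01 near] := step_spec A b X (outer v).
have sX' := spectraplex_nearest sX pv.2.1 near.
have [out [vs' [comp ex sz]]] :=
  IH _ (rcons vs v) sX' (within_step eps01 radP sX naX pv.2 near wX).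
exists out, (v :: vs'); split=> //; last exact: (Sp_step naX pv near ex).
rewrite mulnS -cat_rcons; exact: (spectrahull_loop_step sX naX E comp).
Qed.

Variable sel : selection.
Hypothesis selP : selection_spec sel.
Local Notation loop := (chm_loop A b eps rad sel (start R n) (p (start R n))
  (vdot b b)).

(** The flags of the search as a function. The program passes an equal function to [sel], so its
    answer can be analysed before the run. *)
Definition stored_pivots t (s : store R m n t) X : 'I_t -> bool :=
  fun i => is_pivot A b X (outer (vec s i)).

Lemma gap_store t (s : store R m n t) X : represents s X ->
  xx s - xb s + (vdot b b - xb s) = gap A b X.
Proof. by move=> rs; rewrite (xxE rs) (xbE rs) /gap !vdotE (vdotC b); ring. Qed.

Lemma stored_pivot_test t (s : store R m n t) X i : represents s X ->
  (vdot b b - bimg s i - bimg s i <= xx s - ximg s i - ximg s i) =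
  stored_pivots s X i.
Proof. by move=> rs; rewrite (bimgE rs) (ximgE rs) (xxE rs). Qed.

Ltac chm_pass rs :=
  cbn [chm_loop]; lazy zeta; do 5! computes_by computes_op;
  eapply computes_bind;
  [ by apply: computes_val (computes_leqp _ _ _) _; rewrite /= (gap_store rs)
  | lazy beta ].

Ltac chm_search rs :=
  eapply computes_bind;
  [ by apply: (@computes_tab _ _ _ _ _ _ 5) => ?;
    split; last exact: (stored_pivot_test _ rs)
  | lazy beta ].

Lemma chm_loop_stop fuel k t (s : store R m n t) X used :
  represents s X -> approx_solution A b eps rad X ->
  computes (loop fuel.+1 k s used) (60 * (m * n ^ 2 * t.+1 + m * t))
    (Some (Approx X, stored s, used)).
Proof.
move=> rs aX; have [s1 s2 s3 s4] := dims_le m_gt0 n_gt0.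
have /approx_test gX := aX; have {}gX := gX aX.1.
eapply computes_le.
  chm_pass rs; rewrite gX; lazy iota.
  eapply computes_bind; first exact: computes_iterate rs.
  exact: computes_ret.
nia.
Qed.

(** The factor 41 is 30 for the move, 5 for testing each stored point, and 6 for the stopping test,
    absorbed because [t] is positive. *)
Lemma chm_loop_stored fuel k t (s s' : store R m n t) X used i c res :
  spectraplex X -> represents s X -> ~ approx_solution A b eps rad X ->
  sel k (stored_pivots s X) = Some i ->
  computes (move_to s i) (30 * t) s' ->
  computes (loop fuel k.+1 s' (rcons used (vec s i))) c res ->
  computes (loop fuel.+1 k s used) (41 * t + c) res.
Proof.
move=> sX rs naX E mv rest.
have gX : (gap A b X <= eps * rad * (eps * rad)) = false.
  by apply/negP => /(approx_test sX).
have t0 : (0 < t)%N by case: (i) => j; lia.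
eapply computes_le.
  chm_pass rs; rewrite gX; lazy iota.
  chm_search rs; rewrite E.
  eapply computes_bind; first exact: mv.
  exact: rest.
lia.
Qed.

Lemma chm_loop_generate fuel k t (s : store R m n t) s' X used v c res :
  spectraplex X -> represents s X -> ~ approx_solution A b eps rad X ->
  sel k (stored_pivots s X) = None ->
  oracle (gradient A b X) (threshold A b X) = Some v ->
  computes (grow A b (p X) s v) (20 * (m * n ^ 2 + m * t)) s' ->
  computes (loop fuel k.+1 s' used) c res ->
  computes (loop fuel.+1 k s used) (60 * (m * n ^ 2 + m * t) + c) res.
Proof.
move=> sX rs naX E Ev gr rest; have [s1 s2 s3 s4] := dims_le m_gt0 n_gt0.
have gX : (gap A b X <= eps * rad * (eps * rad)) = false.
  by apply/negP => /(approx_test sX).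
have st : (t <= m * t)%N by nia.
eapply computes_le.
  chm_pass rs; rewrite gX; lazy iota.
  chm_search rs; rewrite E.
  eapply computes_bind; first exact: computes_current rs.
  lazy beta; computes_by computes_residual; computes_by computes_gradient.
  rewrite (xxE rs); computes_by computes_threshold.
  eapply computes_bind; first exact: computes_val (computes_query _ _ _) Ev.
  lazy beta iota; eapply computes_bind; first exact: gr.
  exact: rest.
lia.
Qed.

Lemma chm_loop_witness fuel k t (s : store R m n t) X used :
  spectraplex X -> represents s X -> ~ approx_solution A b eps rad X ->
  sel k (stored_pivots s X) = None ->
  oracle (gradient A b X) (threshold A b X) = None ->
  computes (loop fuel.+1 k s used) (60 * (m * n ^ 2 * t.+1 + m * t))
    (Some (Witness X, stored s, used)).
Proof.
move=> sX rs naX E Ev; have [s1 s2 s3 s4] := dims_le m_gt0 n_gt0.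
have gX : (gap A b X <= eps * rad * (eps * rad)) = false.
  by apply/negP => /(approx_test sX).
have st : (t <= m * t)%N by nia.
have snt : (n ^ 2 * t <= m * n ^ 2 * t)%N by nia.
eapply computes_le.
  chm_pass rs; rewrite gX; lazy iota.
  chm_search rs; rewrite E.
  eapply computes_bind; first exact: computes_current rs.
  lazy beta; computes_by computes_residual; computes_by computes_gradient.
  rewrite (xxE rs); computes_by computes_threshold.
  eapply computes_bind; first exact: computes_val (computes_query _ _ _) Ev.
  lazy beta iota; eapply computes_bind; first exact: computes_iterate rs.
  exact: computes_ret.
lia.
Qed.

Lemma is_pivot_image X V W : p V = p W -> is_pivot A b X V = is_pivot A b X W.
Proof. by rewrite /is_pivot => ->. Qed.

Lemma stored_vec t (s : store R m n t) i : vec s i \in stored s.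
Proof. by apply: map_f; rewrite mem_enum. Qed.

Lemma size_stored t (s : store R m n t) : size (stored s) = t.
Proof. by rewrite size_map size_enum_ord. Qed.

(* In the cost bound the [t] pivots already stored are charged on the left, which
   avoids a truncated subtraction. *)
Lemma chm_loop_spec F fuel k t (s : store R m n t) X used :
  (F.*2 < fuel)%N ->
  spectraplex X -> represents s X -> within A b eps rad F X ->
  uniq [seq p (outer v) | v <- stored s] -> stored s =i used ->
  exists out vs used' c,
  [/\ computes (loop fuel k s used) c (Some (out, vs, used ++ used')),
      chm_exec A b eps rad (stored s) X vs used' out,
      (size used' <= F /\ t <= size vs)%N,
      uniq [seq p (outer v) | v <- vs] /\ vs =i used ++ used' &
      (c + 60 * t * (m * n ^ 2 + m * size vs) <= 41 * size used' * size vs +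
         60 * size vs * (m * n ^ 2 + m * size vs) +
         60 * (m * n ^ 2 * (size vs).+1 + m * size vs))%N].
Proof.
elim: F fuel k t s X used => [|F IH] [//|fuel] k t s X used fuelF sX rs wX
    uq st;
  have [aX|naX] := pselect (approx_solution A b eps rad X).
1,3: exists (Approx X), (stored s), [::], (60 * (m * n ^ 2 * t.+1 + m * t))%N;
  rewrite cats0 size_stored; split=> //;
  [exact: chm_loop_stop | exact: Chm_approx | lia].
  by case: naX; exact: (within0 eps01 radP).
have := selP k (stored_pivots s X).
case E: (sel k (stored_pivots s X)) => [i|] selE.
  have pi : pivot A b X (outer (vec s i)).
    by apply/pivotE => //; exact/spectraplex_outer/(vec_norm rs).
  have [a01 near] := step_spec A b X (outer (vec s i)).
  have [s' [mv rs' vs'E]] := computes_move_to oracle i rs.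
  have sX' := spectraplex_nearest sX pi.1 near.
  have s'E : stored s' = stored s by rewrite /stored vs'E.
  have wX' := within_step eps01 radP sX naX pi near wX.
  have [|||out [vs [used' [c [comp ex [sz tvs] [uq' vsE] cE]]]]] :=
    IH fuel k.+1 _ _ _ (rcons used (vec s i)) _ sX' rs' wX'.
  - lia.
  - by rewrite s'E.
  - move=> v; rewrite s'E mem_rcons inE -st.
    by case: eqP => // ->; rewrite stored_vec.
  rewrite cat_rcons in comp vsE.
  exists out, vs, (vec s i :: used'), (41 * t + c)%N; split=> //.
  + exact: (chm_loop_stored sX rs naX E mv comp).
  + by apply: (Chm_stored naX _ pi near); [exact: stored_vec | rewrite -s'E].
  + exact: (stored_cost tvs cE).
have npiv w : w \in stored s -> ~ pivot A b X (outer w).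
  case/mapP => i _ -> /pivotE pv; have := selE i.
  by rewrite /stored_pivots pv //; exact/spectraplex_outer/(vec_norm rs).
case Ev: (oracle (gradient A b X) (threshold A b X)) => [v|]; last first.
  exists (Witness X), (stored s), [::], (60 * (m * n ^ 2 * t.+1 + m * t))%N.
  rewrite cats0 size_stored; split=> //; [exact: chm_loop_witness | | lia].
  by apply: Chm_witness => //; exact: oracle_witness.
have pv := oracle_pivot Ev; have [v1 piv] := pv.
have [s1 [gr rs1 vs1E]] := computes_grow oracle rs v1 m_gt0 n_gt0.
have s1E := stored_frcons vs1E.
have pivv : is_pivot A b X (outer v) by apply/pivotE => //; case: piv.
(* The next pass, still at [X], is analysed here: the induction hypothesis becomes available only
   after a move. This is why each unit of [F] costs two units of fuel. *)
have := selP k.+1 (stored_pivots s1 X).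
case E1: (sel k.+1 (stored_pivots s1 X)) => [i|] selE1; last first.
  by have := selE1 ord_max; rewrite /stored_pivots vs1E frcons_max pivv.
have iv : vec s1 i = v.
  move: selE1; rewrite /stored_pivots vs1E.
  case: (unliftP ord_max i) => [j|] ->; rewrite ?frcons_max // frcons_lift.
  by move=> pj; have := selE j; rewrite /stored_pivots pj.
case: fuel fuelF => [|fuel] fuelF; first by [].
have near := (step_spec A b X (outer v)).2.
have [s' [mv rs' vs'E]] := computes_move_to oracle i rs1; rewrite iv in mv rs'.
have sX' := spectraplex_nearest sX piv.1 near.
have s'E : stored s' = rcons (stored s) v by rewrite /stored vs'E.
have wX' := within_step eps01 radP sX naX piv near wX.
have [|||out [vs [used' [c [comp ex [sz tvs] [uq' vsE] cE]]]]] :=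
  IH fuel k.+2 _ _ _ (rcons used v) _ sX' rs' wX'.
- lia.
(* Being a pivot depends only on the image, so a stored vector with the image of [v] would itself
   have been a pivot. *)
- rewrite s'E map_rcons rcons_uniq uq andbT; apply/mapP => -[w ws vw].
  apply: (npiv w ws); apply/pivotE; last by rewrite -(is_pivot_image X vw).
  by case/mapP: ws => j _ ->; exact/spectraplex_outer/(vec_norm rs).
- by move=> w; rewrite s'E !mem_rcons !inE st.
rewrite cat_rcons in comp vsE.
exists out, vs, (v :: used'), (60 * (m * n ^ 2 + m * t) + (41 * t.+1 + c))%N.
split=> //.
- apply: (chm_loop_generate sX rs naX E Ev gr).
  by apply: (chm_loop_stored sX rs1 naX E1 mv); rewrite iv.
- apply: (Chm_generate naX npiv pv); apply: (Chm_stored naX _ piv near).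
  + by rewrite mem_rcons mem_head.
  + by rewrite -s'E.
- by split=> //; exact: ltnW.
- exact: (generate_cost tvs cE).
Qed.


Lemma spectrahull_spec : exists (F fuel : nat) out vs,
  [/\ computes (spectrahull A b eps rad fuel)
        (63 * (m * n ^ 2) * (size vs).+1) (Some (out, vs)),
      spectrahull_exec A b eps rad (start R n) vs out,
      (size vs <= F)%N & F%:R <= 17 / eps ^+ 2].
Proof.
have [s1 s2 s3 s4] := dims_le m_gt0 n_gt0.
have sX := spectraplex_start R n_gt0.
have [F wF F17] := within_start A b rad eps01 sX.
have [out [vs [comp ex sz]]] := spectrahull_loop_spec [::] sX wF.
exists F, F.+1, out, vs; split=> //.
eapply computes_le; first by computes_by computes_start; exact: comp.
by nia.
Qed.

(** [used] has repetitions, but it contains the same vectors as [vs], whose images are distinct; one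
    image per generated vector survives. *)
Lemma num_images_eq (vs used : seq 'cV[R]_n) :
  uniq [seq p (outer v) | v <- vs] -> vs =i used ->
  num_images A used = size vs.
Proof.
move=> uq vu; rewrite /num_images -(size_map (fun v => p (outer v)) vs).
apply/perm_size/uniq_perm => //; first exact: undup_uniq.
by move=> x; rewrite mem_undup; apply/esym/eq_mem_map.
Qed.

Lemma chm_triangle_spec : exists (F fuel c : nat) out vs used,
  [/\ computes (chm_triangle A b eps rad sel fuel) c (Some (out, vs, used)),
      chm_exec A b eps rad [::] (start R n) vs used out,
      num_images A used = size vs,
      (size vs <= F)%N /\ F%:R <= 17 / eps ^+ 2 &
      (c <= 41 * F * size vs + 60 * size vs * (m * n ^ 2 + m * size vs) +
         60 * (m * n ^ 2 * (size vs).+1 + m * size vs) + 18 * (m * n ^ 2))%N].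
Proof.
have [s1 s2 s3 s4] := dims_le m_gt0 n_gt0.
have sX := spectraplex_start R n_gt0.
have [F wF F17] := within_start A b rad eps01 sX.
pose p0 := p (start R n).
pose s := Store (@ord_elim0 'cV[R]_n) (@ord_elim0 'cV[R]_m)
  (@ord_elim0 ('I_0 -> R)) (@ord_elim0 R) (@ord_elim0 R) (@ord_elim0 R) 1
  (vdot p0 p0) (vdot p0 b).
have rs : represents s (start R n).
  by split=> //=; try (by case); rewrite big_ord0 addr0 scale1r.
have s0 : stored s = [::] by apply: size0nil; rewrite size_stored.
have [|||out [vs [used [c [comp ex [sz _] [uq vsE] cE]]]]] :=
  @chm_loop_spec F F.*2.+1 0 0 s _ [::] _ sX rs wF.
- by [].
- by rewrite s0.
- by rewrite s0.
(* Generations are bounded through moves: the generated vectors are distinct and each occurs in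
   [used], whose length is at most [F]. *)
have vsF : (size vs <= F)%N.
  apply: leq_trans sz; apply: uniq_leq_size; first exact: map_uniq uq.
  by move=> v; rewrite vsE.
rewrite s0 in ex.
(* In units of m n^2 the initialization costs at most 3 for the start, 5 for its image, 9 for three
   inner products and 1 for a constant, 18 in all. *)
exists F, F.*2.+1, (18 * (m * n ^ 2) + c)%N, out, vs, used; split=> //.
- eapply computes_le.
    rewrite /chm_triangle; computes_by computes_start.
    computes_by computes_image; computes_by computes_dot_cV.
    computes_by computes_dot_cV; computes_by computes_dot_cV.
    computes_by computes_cst; exact: comp.
  lia.
- exact: num_images_eq.
- rewrite addnC leq_add2r; move: cE; rewrite muln0 mul0n addn0.
  by move=> /leq_trans; apply; rewrite !leq_add2r leq_mul2r leq_mul2l sz !orbT.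
Qed.

End Algorithms.

(** The case T = 0 is separate because the CHM bound then vanishes, while computing p(X') at the
    start already costs operations. *)
Theorem theorem15 (R : realType) :
  exists C : nat, forall (m n : nat) (A : 'I_m -> 'M[R]_n) (b : 'cV[R]_m)
    (eps rad : R) (oracle : 'M[R]_n -> R -> option 'cV[R]_n) (sel : selection),
  (0 < m)%N -> (0 < n)%N -> (forall i, (A i)^T = A i) ->
  0 < eps < 1 -> is_radius A b rad ->
  power_method_spec oracle -> selection_spec sel ->
  (exists (fuel cost : nat) (out : outcome R n) (vs : seq 'cV[R]_n),
    [/\ run oracle (spectrahull A b eps rad fuel) = (cost, Some (out, vs)),
        spectrahull_exec A b eps rad (start R n) vs out,
        ((size vs)%:R : R) <= C%:R / eps ^+ 2 &
        (cost%:R : R) <= C%:R * (m%:R * n%:R ^+ 2 / eps ^+ 2)]) /\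
  (exists (fuel cost : nat) (out : outcome R n) (vs used : seq 'cV[R]_n),
    let T := size vs in
    let N := num_images A used in
    [/\ run oracle (chm_triangle A b eps rad sel fuel)
          = (cost, Some (out, vs, used)),
        chm_exec A b eps rad [::] (start R n) vs used out,
        (N <= T)%N /\ (T%:R : R) <= C%:R / eps ^+ 2,
        (0 < T)%N ->
          (cost%:R : R) <= C%:R * (m%:R * n%:R ^+ 2 * T%:R + m%:R * N%:R ^+ 2
                             + N%:R / eps ^+ 2) &
        T = 0%N -> (cost%:R : R) <= C%:R * (m%:R * n%:R ^+ 2)]).
Proof.
(* The first algorithm needs 63 * 18 = 1134; the CHM-based one needs 41 * 17 = 697 for N / eps^2,
   and less for the other terms. *)
exists 1200 => m n A b eps rad oracle sel m0 n0 symA eps01 radP oracleP selP.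
have e0 : 0 < eps ^+ 2 by rewrite exprn_gt0; case/andP: eps01.
have e1 : 1 <= (eps ^+ 2)^-1.
  by case/andP: eps01 => ? ?; rewrite invf_ge1 ?exprn_ile1 ?ltW.
have mn0 : 0 <= m%:R * n%:R ^+ 2 :> R by rewrite mulr_ge0 ?sqr_ge0.
have mnE : (m * n ^ 2)%:R = m%:R * n%:R ^+ 2 :> R by rewrite natrM natrX.
split.
  have [F [fuel [out [vs [[cle val] ex szF F17]]]]] :=
    spectrahull_spec m0 n0 symA eps01 radP oracleP.
  have szF' : (size vs)%:R <= F%:R :> R by rewrite ler_nat.
  exists fuel, (run oracle (spectrahull A b eps rad fuel)).1, out, vs.
  split=> //; first by rewrite -val -surjective_pairing.
    by apply: (le_trans szF'); lra.
  move: cle; rewrite -(ler_nat R) => /le_trans; apply.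
  rewrite 2!natrM mnE -(natr1 (size vs)).
  have : (m%:R * n%:R ^+ 2) * ((size vs)%:R + 1) <=
         (m%:R * n%:R ^+ 2) * (18 / eps ^+ 2) by apply: ler_wpM2l => //; lra.
  have : 0 <= m%:R * n%:R ^+ 2 * (eps ^+ 2)^-1.
    by rewrite mulr_ge0 // ltW ?invr_gt0.
  lra.
have [F [fuel [c [out [vs [used [[cle val] ex NT [szF F17] cE]]]]]]] :=
  chm_triangle_spec m0 n0 symA eps01 radP oracleP selP.
exists fuel, (run oracle (chm_triangle A b eps rad sel fuel)).1, out, vs, used.
have szF' : (size vs)%:R <= F%:R :> R by rewrite ler_nat.
have {}cle := leq_trans cle cE.
split=> //; first by rewrite -val -surjective_pairing.
- by rewrite NT; split=> //; apply: (le_trans szF'); lra.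
- rewrite NT; move: (size vs) szF szF' cle => T szF szF' cle T0.
  (* T >= 1 absorbs the terms without T: 198 = 60 + 2 * 60 + 18 collects generations, last pass and
     initialization, and 120 = 60 + 60 the terms in m T^2. *)
  have {}cle : ((run oracle (chm_triangle A b eps rad sel fuel)).1 <=
    41 * F * T + 198 * (m * n ^ 2 * T) + 120 * (m * T ^ 2))%N.
    apply: (leq_trans cle).
    have : (m * n ^ 2 <= m * n ^ 2 * T)%N by rewrite leq_pmulr.
    have : (m * T <= m * T ^ 2)%N by rewrite leq_mul2l -mulnn leq_pmulr ?orbT.
    lia.
  move: cle; rewrite -(ler_nat R) => /le_trans; apply.
  rewrite 2!natrD (natrM _ (41 * F)) (natrM _ 41) (natrM _ 198).
  rewrite (natrM _ (m * n ^ 2)) mnE (natrM _ 120) (natrM _ m) natrX.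
  have FT : F%:R * T%:R <= 17 / eps ^+ 2 * T%:R by apply: ler_wpM2r.
  have h1 : 0 <= m%:R * n%:R ^+ 2 * T%:R :> R by rewrite mulr_ge0.
  have h2 : 0 <= m%:R * T%:R ^+ 2 :> R by rewrite mulr_ge0 ?sqr_ge0.
  have h3 : 0 <= T%:R / eps ^+ 2 by rewrite divr_ge0 // ltW.
  lra.
- move=> T0; move: cle; rewrite T0 => cle.
  (* Only the last pass (60) and the initialization (18) remain. *)
  have {}cle : ((run oracle (chm_triangle A b eps rad sel fuel)).1 <=
    78 * (m * n ^ 2))%N by apply: (leq_trans cle); lia.
  move: cle; rewrite -(ler_nat R) => /le_trans; apply.
  by rewrite natrM mnE; lra.
Qed.
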